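(* Let $\mathcal{H}$ be a complex separable Hilbert space, let $\Phi=(\phi_n)_{n=1}^\infty$ and $\Psi=(\psi_n)_{n=1}^\infty$ be frames for $\mathcal{H}$, and let $c$ be a non-zero constant. The following statements are equivalent. \begin{itemize} \item[(a)] $M_{(c),\Phi,\Psi}$ is invertible and $M_{(c),\Phi,\Psi}^{-1}=M_{(1/c),\widetilde{\Psi},\widetilde{\Phi}}$. \item[(b)] $\Phi$ and $\Psi$ are equivalent frames. \item[(c1)] $M_{(c),\Phi,\Psi}$ is invertible and the unique dual frame $\Psi^\dagger$ of $\Psi$ satisfying $M_{(c),\Phi,\Psi}^{-1}=M_{(1/c),\Psi^\dagger,\Phi^d}$ for all dual frames $\Phi^d$ of $\Phi$ is $\widetilde{\Psi}$. \item[(c2)] $M_{(c),\Phi,\Psi}$ is invertible and the unique dual frame $\Phi^\dagger$ of $\Phi$ satisfying $M_{(c),\Phi,\Psi}^{-1}=M_{(1/c),\Psi^d,\Phi^\dagger}$ for all dual frames $\Psi^d$ of $\Psi$ is $\widetilde{\Phi}$. \item[(d1)] $M_{(c),\Phi,\Psi}$ is invertible and $M_{(c),\Phi,\Psi}^{-1}=M_{(1/c),\widetilde{\Psi},\Phi^d}$ for all dual frames $\Phi^d$ of $\Phi$. \item[(d2)] $M_{(c),\Phi,\Psi}$ is invertible and $M_{(c),\Phi,\Psi}^{-1}=M_{(1/c),\Psi^d,\widetilde{\Phi}}$ for all dual frames $\Psi^d$ of $\Psi$. \end{itemize}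
   Context: A sequence $\Phi=(\phi_n)_{n=1}^\infty$ in $\mathcal{H}$ is a frame for $\mathcal{H}$ if there are $0<A\le B<\infty$ with $A\|h\|^2\le\sum_n|\langle h,\phi_n\rangle|^2\le B\|h\|^2$ for all $h\in\mathcal{H}$. A dual frame of a frame $\Phi$ is a frame $\Phi^d=(\phi^d_n)$ for $\mathcal{H}$ with $h=\sum_n\langle h,\phi^d_n\rangle\phi_n$ for all $h\in\mathcal{H}$. The frame operator is $S_\Phi h=\sum_n\langle h,\phi_n\rangle\phi_n$ and the canonical dual of $\Phi$ is the dual frame $\widetilde{\Phi}=(S_\Phi^{-1}\phi_n)$. Two frames $\Phi,\Psi$ for $\mathcal{H}$ are equivalent if there is an invertible operator $G:\mathcal{H}\to\mathcal{H}$ with $\psi_n=G\phi_n$ for all $n\in\mathbb{N}$. An operator $\mathcal{H}\to\mathcal{H}$ is invertible if it is a bounded bijection of $\mathcal{H}$ onto $\mathcal{H}$. For a complex sequence $m$ and sequences $\Phi,\Psi$ in $\mathcal{H}$, the multiplier is $M_{m,\Phi,\Psi}h=\sum_{n=1}^\infty m_n\langle h,\psi_n\rangle\phi_n$ (inner product linear in the first argument); it is well defined and bounded when $m\in\ell^\infty$ and $\Phi,\Psi$ are frames. $(c)$ and $(1/c)$ denote constant sequences. Whenever $M_{(c),\Phi,\Psi}$ is invertible, the dual frames $\Psi^\dagger$ and $\Phi^\dagger$ described in (c1) and (c2) exist and are unique. *)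

(* Defs.v *)
From HB Require Import structures.
From mathcomp Require Import all_boot all_order all_algebra.
From mathcomp Require Import all_classical all_reals all_analysis.
From mathcomp Require Import complex.
Import Order.TTheory GRing.Theory Num.Theory.
Import numFieldNormedType.Exports.

Set Implicit Arguments.
Unset Strict Implicit.
Unset Printing Implicit Defensive.

Local Open Scope classical_set_scope.
Local Open Scope ring_scope.

(* A complex Hilbert space is a [completeNormedModType R[i]] together with an
   inner product [dot : {dot H for Num.conj}], linear in its first argument and
   conjugate-linear in the second, that induces the norm. *)
Definition induces_norm (R : realType) (H : completeNormedModType R[i])
    (dot : {dot H for Num.conj}) : Prop :=
  forall h : H, `|h| = sqrtC (dot h h).

Definition separable (T : topologicalType) : Prop :=
  exists2 D : set T, countable D & dense D.

(* The library's norms on [H] and on [R[i]] take values in [R[i]]. *)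
Definition rnorm (R : realType) (V : normedZmodType R[i]) (x : V) : R :=
  complex.Re `|x|.

Section Frames.
Context (R : realType) (H : completeNormedModType R[i])
  (dot : {dot H for Num.conj}).
Implicit Types (Phi Psi : nat -> H) (m : nat -> R[i]) (T : H -> H).

(* Sequences are indexed from 0, so the n-th term is phi_(n+1). *)
Definition is_frame Phi : Prop :=
  exists A B : R, [/\ 0 < A, A <= B & forall h : H,
    ((A * rnorm h ^+ 2)%:E
       <= \sum_(0 <= n <oo) (rnorm (dot h (Phi n)) ^+ 2)%:E)%E /\
    (\sum_(0 <= n <oo) (rnorm (dot h (Phi n)) ^+ 2)%:E
       <= (B * rnorm h ^+ 2)%:E)%E].

Definition is_dual_frame Phi Phid : Prop :=
  is_frame Phid /\
  forall h : H, series (fun n => dot h (Phid n) *: Phi n) @ \oo --> h.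

(* A junk value where the series diverges. *)
Definition multiplier m Phi Psi : H -> H :=
  fun h => limn (series (fun n => (m n * dot h (Psi n)) *: Phi n)).

Definition frame_operator Phi : H -> H :=
  fun h => limn (series (fun n => dot h (Phi n) *: Phi n)).

Definition invertible T : Prop :=
  [/\ linear T, exists C : R, forall h, rnorm (T h) <= C * rnorm h
    & bijective T].

(* The two-sided inverse of [T] when [T] is bijective. *)
Definition inverse T : H -> H := 'pinv_(fun=> 0) setT T.

Definition canonical_dual Phi : nat -> H :=
  fun n => inverse (frame_operator Phi) (Phi n).

Definition equivalent_frames Phi Psi : Prop :=
  exists2 G : H -> H, invertible G & forall n, Psi n = G (Phi n).

End Frames.

(* Main.v *)
(** Write [D X Y h = sum <h, Y_n> X_n] and [S_X = D X X]; then [D X Y] has adjoint [D Y X],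
    and [M = c D Phi Psi].

    If [Psi = G Phi], then [G (D Phi Y) = D Psi Y], so [G (D Phi Psi) = S_Psi] gives
    [M^-1 = c^-1 S_Psi^-1 G] without inverting [G] as a bounded operator, and [(d1)] follows
    from [D Phi Phi^d = id].  Dually [Phi_n = D Phi Psi (S_Psi^-1 Psi_n)], so that
    [<h, Phi_n> = <S_Psi^-1 G S_Phi h, Psi_n>], which gives [(d2)].

    Conversely, [(a)] says that [D Phi Psi] is inverse to [S_Psi^-1 (D Psi Phi) S_Phi^-1].
    With [T = S_Psi^-1 (D Psi Phi)], the sequence [<h, Phi_n> - <T h, Psi_n>] is then killed
    by the synthesis operators of both [Phi] and [Psi], so its own norm is zero; hence
    [Psi_n = G Phi_n] for [G = D Psi Phi S_Phi^-1].

    Uniqueness in [(c1)] and [(c2)]: the duals of [Phi] detect every coefficient sequence in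
    the kernel of the synthesis operator, because adding such a sequence times a fixed vector
    to a dual frame gives another dual frame. *)
Require Import Defs.
From mathcomp Require Import all_boot all_order all_algebra.
From mathcomp Require Import all_classical all_reals all_analysis.
From mathcomp Require Import complex.
From mathcomp Require Import ring lra.
Import Order.TTheory GRing.Theory Num.Theory.
Import numFieldNormedType.Exports.

Set Implicit Arguments.
Unset Strict Implicit.
Unset Printing Implicit Defensive.

Local Open Scope classical_set_scope.
Local Open Scope ring_scope.

(** * Real-valued norms and the Cauchy-Schwarz inequality *)

Section RealNorm.
Context {R : realType} {V : normedZmodType R[i]}.
Implicit Types x y : V.

Lemma rnormE x : `|x| = (rnorm x)%:C%C.
Proof. by rewrite /rnorm RRe_real ?normr_real. Qed.

Lemma rnorm_ge0 x : 0 <= rnorm x.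
Proof. rewrite -lecR -rnormE; exact: normr_ge0. Qed.

Lemma rnorm0 : rnorm (0 : V) = 0.
Proof. by rewrite /rnorm normr0. Qed.

Lemma rnorm_eq0 x : rnorm x = 0 -> x = 0.
Proof. by move=> x0; apply/eqP; rewrite -normr_eq0 rnormE x0. Qed.

Lemma rnormD x y : rnorm (x + y) <= rnorm x + rnorm y.
Proof. by rewrite -lecR rmorphD /= -!rnormE ler_normD. Qed.

Lemma rnormN x : rnorm (- x) = rnorm x.
Proof. by rewrite /rnorm normrN. Qed.

Lemma rnorm_sqrD x y : rnorm (x + y) ^+ 2 <= 2 * (rnorm x ^+ 2 + rnorm y ^+ 2).
Proof.
have := rnormD x y; have := rnorm_ge0 (x + y).
have := sqr_ge0 (rnorm x - rnorm y).
have := rnorm_ge0 x; have := rnorm_ge0 y; nra.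
Qed.

End RealNorm.

Section ComplexRe.
Context {R : realType}.
Implicit Types (a b : R[i]) (x : R).

Lemma rnormM a b : rnorm (a * b) = rnorm a * rnorm b.
Proof. by apply: complexI; rewrite rmorphM /= -!rnormE normrM. Qed.

Lemma rnormZ {V : normedModType R[i]} a (v : V) : rnorm (a *: v) = rnorm a * rnorm v.
Proof. by apply: complexI; rewrite rmorphM /= -!rnormE normrZ. Qed.

Lemma rnormJ a : rnorm a^*%R = rnorm a.
Proof. by rewrite /rnorm norm_conjC. Qed.

Lemma Re_le_rnorm a : complex.Re a <= rnorm a.
Proof.
apply: le_trans (ler_norm _) _; rewrite -lecR -rnormE; exact: normc_ge_Re.
Qed.

Lemma rnorm_real x : 0 <= x -> rnorm (x%:C%C : R[i]) = x.
Proof. by move=> x0; rewrite /rnorm ger0_norm // lecR. Qed.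

Lemma mul_conj_rnorm a : a * a^*%R = (rnorm a ^+ 2)%:C%C.
Proof. by rewrite -normCK rnormE rmorphXn. Qed.

Lemma ReD a b : complex.Re (a + b) = complex.Re a + complex.Re b.
Proof. by case: a b => [? ?] [? ?]. Qed.

Lemma Re_realM x a : complex.Re (x%:C%C * a) = x * complex.Re a.
Proof. by case: a => ? ? /=; rewrite mul0r subr0. Qed.

Lemma Re_sum (n : nat) (u : nat -> R[i]) :
  complex.Re (\sum_(0 <= k < n) u k) = \sum_(0 <= k < n) complex.Re (u k).
Proof.
by elim: n => [|n IH]; rewrite ?big_nil // !big_nat_recr //= ReD IH.
Qed.

(** Comparable elements of [R[i]] have equal imaginary parts, so every positive radius in a limit
    over [R[i]] is real. *)
Lemma complex_gt0_real (e : R[i]) : 0 < e -> exists2 r : R, 0 < r & e = r%:C%C.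
Proof.
by case: e => r i; rewrite ltcE /= => /andP[/eqP-> r0]; exists r.
Qed.

End ComplexRe.

Section InnerProduct.
Context {R : realType} {H : completeNormedModType R[i]} {dot : {dot H for Num.conj}}.
Hypothesis Hdot : induces_norm dot.
Implicit Types (x y z : H).

Lemma dotC x y : dot x y = (dot y x)^*%R.
Proof. by rewrite hermC expr0 mul1r. Qed.

Lemma dot_rnorm x : dot x x = (rnorm x ^+ 2)%:C%C.
Proof. by rewrite rmorphXn /= -rnormE Hdot sqrtCK. Qed.

Lemma dotDl x y z : dot (x + y) z = dot x z + dot y z. Proof. exact: linearDl. Qed.
Lemma dotBl x y z : dot (x - y) z = dot x z - dot y z. Proof. exact: linearBl. Qed.
Lemma dotZl a x z : dot (a *: x) z = a * dot x z. Proof. exact: linearZl_LR. Qed.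
Lemma dotDr x y z : dot z (x + y) = dot z x + dot z y. Proof. exact: linearDr. Qed.
Lemma dotBr x y z : dot z (x - y) = dot z x - dot z y. Proof. exact: linearBr. Qed.
Lemma dotZr a x z : dot z (a *: x) = a^*%R * dot z x. Proof. exact: linearZr_LR. Qed.
Lemma dot0l z : dot 0 z = 0. Proof. exact: linear0l. Qed.

Lemma dot_inj x y : (forall z, dot x z = dot y z) -> x = y.
Proof.
move=> xy; apply/eqP; rewrite -subr_eq0 -(dnorm_eq0 dot) dotBl xy subrr //.
Qed.

Lemma rnorm_sqrB x y :
  rnorm (x - y) ^+ 2 = rnorm x ^+ 2 - 2 * complex.Re (dot x y) + rnorm y ^+ 2.
Proof.
apply: complexI; rewrite -dot_rnorm dnormB !dot_rnorm addcJ.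
rewrite !(rmorphD, rmorphN, rmorphM) /=; ring.
Qed.

(* Expand [|y|^2 x - <x,y> y|^2 >= 0]. *)
Lemma Cauchy_Schwarz x y : rnorm (dot x y) <= rnorm x * rnorm y.
Proof.
have [->|y0] := eqVneq y 0.
  by rewrite rnorm0 mulr0 (_ : dot x 0 = 0) ?rnorm0 //; exact: linear0r.
have ny : 0 < rnorm y.
  by rewrite lt_def rnorm_ge0 andbT; apply: contra_neq y0; exact: rnorm_eq0.
rewrite -ler_sqr ?nnegrE ?mulr_ge0 ?rnorm_ge0 // exprMn.
have := sqr_ge0 (rnorm ((rnorm y ^+ 2)%:C%C *: x - dot x y *: y)).
rewrite rnorm_sqrB !rnormZ dotZl dotZr.
rewrite [_^* * _]mulrC mul_conj_rnorm rnorm_real ?sqr_ge0 // Re_realM /= => h.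
rewrite -(ler_pM2l (exprn_gt0 2 ny)); nra.
Qed.

End InnerProduct.

(** * Completeness *)

(** The second hypothesis makes [a] nondecreasing; past an index where [a] is within [r ^+ 2] of its
    supremum, [u] stays within [r] of its value there. *)
Lemma cvgn_sqr_tail {R : realType} {V : completeNormedModType R[i]} (u : nat -> V)
    (a : nat -> R) (K : R) :
  (forall n, a n <= K) ->
  (forall n m, (n <= m)%N -> rnorm (u m - u n) ^+ 2 <= a m - a n) ->
  cvgn u.
Proof.
move=> aK ua; apply/cauchy_cvgP; apply: cauchy_exP => e /complex_gt0_real[r r0 ->].
have hs : has_sup (range a).
  by split; [exists (a 0); exists 0 | exists K => _ [n _ <-]].
have [_ [N _ <-] hN] := sup_adherent (exprn_gt0 2 r0) hs.
exists (u N); exists N => // m /= Nm.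
rewrite -ball_normE /= rnormE -rnormN opprB ltcR.
rewrite -ltr_sqr ?nnegrE ?rnorm_ge0 ?ltW //.
apply: le_lt_trans (ua _ _ Nm) _.
rewrite ltrBlDl -ltrBlDr; apply: le_lt_trans hN; rewrite lerD2r.
by apply: ub_le_sup => //; case: hs.
Qed.

Lemma lipschitz_continuous_rnorm {R : realType} {U V : normedModType R[i]} (T : U -> V)
    (C : R) :
  (forall x y, rnorm (T x - T y) <= C * rnorm (x - y)) -> continuous T.
Proof.
move=> TC x; apply/cvgrPdist_lt => e /complex_gt0_real[r r0 ->].
(* The constant [C] may be zero or negative, hence the passage to |C| + 1. *)
have C1 : 0 < `|C| + 1 by rewrite ltr_wpDl.
have d0 : 0 < ((r / (`|C| + 1))%:C%C : R[i]) by rewrite ltcR divr_gt0.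
have /(_ _ _ d0) := (@cvgrPdist_lt _ _ _ _ _ (fun y : U => y) x).1 (fun _ => id).
apply: filterS => y; rewrite !rnormE !ltcR ltr_pdivlMr // => xy.
apply: le_lt_trans (TC _ _) _; apply: le_lt_trans xy; rewrite mulrC.
by rewrite ler_wpM2l ?rnorm_ge0 //; have := ler_norm C; lra.
Qed.

Lemma contraction_fixpoint {R : realType} {V : completeNormedModType R[i]} (F : V -> V)
    (q : R) : 0 <= q < 1 ->
  (forall x y, rnorm (F x - F y) <= q * rnorm (x - y)) -> exists x, F x = x.
Proof.
move=> /andP[q0 q1] Fq; pose u n := iter n F 0; pose d := rnorm (F 0).
pose s n := d * \sum_(0 <= k < n) q ^+ k.
have uS n : rnorm (u n.+1 - u n) <= d * q ^+ n.
  elim: n => [|n IH]; first by rewrite /u /= subr0 expr0 mulr1.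
  by apply: le_trans (Fq _ _) _; rewrite exprS mulrCA ler_wpM2l.
have s0 n : 0 <= s n.
  by rewrite mulr_ge0 ?rnorm_ge0 ?sumr_ge0 // => k _; exact: exprn_ge0.
have sK n : s n <= d / (1 - q).
  rewrite ler_wpM2l ?rnorm_ge0 // -[_^-1]mul1r ler_pdivlMr ?subr_gt0 //.
  by rewrite -lerN2 -mulrN opprB big_mkord mulrC -subrX1 lerDr exprn_ge0.
have su n m : (n <= m)%N -> rnorm (u m - u n) <= s m - s n.
  move=> /subnK <-; elim: (m - n)%N => [|k IH]; first by rewrite !subrr rnorm0.
  rewrite addSn -(subrK (u (k + n)%N) (u _.+1)) -addrA.
  apply: le_trans (rnormD _ _) _; apply: le_trans (lerD (uS _) IH) _.
  by rewrite /s big_nat_recr //= mulrDr; lra.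
have cu : cvgn u.
  pose K := d / (1 - q).
  (* As [s] takes values in [0, K], squared distances are at most (s m - s n)^2 <= K (s m - s n), so
     [K * s] controls the tails. *)
  apply: (@cvgn_sqr_tail _ _ u (fun n => K * s n) (K * K)) => [n|n m nm].
    by rewrite ler_wpM2l ?sK // (le_trans (s0 0) (sK 0)).
  have := su _ _ nm; have := rnorm_ge0 (u m - u n).
  have := s0 n; have := sK m; rewrite -/K; nra.
exists (limn u); apply: (@cvg_unique _ (@norm_hausdorff _ V) (u @ \oo)) => //.
rewrite /= -(cvg_shiftS u) /=; apply: cvg_comp cu _.
exact: lipschitz_continuous_rnorm Fq _.
Qed.

(** * Bessel sequences and synthesis *)

Section Synthesis.
Context {R : realType} {H : completeNormedModType R[i]} {dot : {dot H for Num.conj}}.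
Hypothesis Hdot : induces_norm dot.
Implicit Types (x y h g : H) (X Y : nat -> H) (a b : nat -> R[i]).

Definition square_summable a : Prop :=
  exists K : R, forall n, \sum_(0 <= k < n) rnorm (a k) ^+ 2 <= K.

(** The upper frame bound, on finite partial sums and with [B] positive so that it can serve as a
    weight together with [B^-1]. *)
Definition bessel (dot : {dot H for Num.conj}) X : Prop :=
  exists2 B : R, 0 < B &
    forall h n, \sum_(0 <= k < n) rnorm (dot h (X k)) ^+ 2 <= B * rnorm h ^+ 2.

Definition synthesis X a : H := limn (series (fun n => a n *: X n)).

Lemma square_summable_comb c a b :
  square_summable a -> square_summable b ->
  square_summable (fun n => c * a n + b n).
Proof.
move=> [K aK] [L bL]; exists (2 * (rnorm c ^+ 2 * K + L)) => n.
apply: (@le_trans _ _ (\sum_(0 <= k < n)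
    2 * (rnorm c ^+ 2 * rnorm (a k) ^+ 2 + rnorm (b k) ^+ 2))).
  by apply: ler_sum => k _; rewrite -exprMn -rnormM; exact: rnorm_sqrD.
rewrite -mulr_sumr big_split /= -mulr_sumr ler_pM2l //.
by apply: lerD (bL _); apply: ler_wpM2l; rewrite ?sqr_ge0.
Qed.

Lemma square_summable_finite a (n : nat) :
  (forall k, (n <= k)%N -> a k = 0) -> square_summable a.
Proof.
move=> a0; exists (\sum_(0 <= k < n) rnorm (a k) ^+ 2) => m.
have [mn|/ltnW nm] := leqP m n.
  rewrite (big_cat_nat (n := m) (p := n)) //= lerDl sumr_ge0 // => i _.
  exact: sqr_ge0.
rewrite (big_cat_nat (n := n) (p := m)) //= [X in _ + X]big_nat [X in _ + X]big1 ?addr0 //.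
by move=> i /andP[ni _]; rewrite a0 // rnorm0 expr0n.
Qed.

Lemma bessel_analysis X h : bessel dot X -> square_summable (fun n => dot h (X n)).
Proof. by move=> [B _ XB]; exists (B * rnorm h ^+ 2). Qed.

(* With [v] the sum, [|v|^2 = sum a_k <X_k, v>], and Young's inequality weighted by the
   Bessel bound absorbs half of [|v|^2]. *)
Lemma rnorm_sum_bessel X (B : R) a n m : 0 < B ->
  (forall h n, \sum_(0 <= k < n) rnorm (dot h (X k)) ^+ 2 <= B * rnorm h ^+ 2) ->
  rnorm (\sum_(n <= k < m) a k *: X k) ^+ 2 <= B * \sum_(n <= k < m) rnorm (a k) ^+ 2.
Proof.
move=> B0 XB; set v := \sum_(_ <= _ < _) _ *: _.
have [mn|/ltnW nm] := leqP m n.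
  by rewrite /v !big_geq // rnorm0 expr0n mulr0.
have vX : \sum_(n <= k < m) rnorm (dot v (X k)) ^+ 2 <= B * rnorm v ^+ 2.
  apply: le_trans (XB v m); rewrite [leRHS](big_cat_nat (n := n)) //= lerDr.
  by apply: sumr_ge0 => i _; exact: sqr_ge0.
have vv : rnorm v ^+ 2 = complex.Re (\sum_(n <= k < m) a k * dot (X k) v).
  rewrite -[LHS]/(complex.Re (rnorm v ^+ 2)%:C%C) -(dot_rnorm Hdot) {1}/v linear_sumlz.
  by congr complex.Re; apply: eq_bigr => k _; exact: dotZl.
have : rnorm v ^+ 2 <=
    \sum_(n <= k < m) (B * rnorm (a k) ^+ 2 + B^-1 * rnorm (dot v (X k)) ^+ 2) / 2.
  rewrite vv (big_morph _ ReD (erefl : complex.Re (0 : R[i]) = 0)).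
  apply: ler_sum => k _; apply: le_trans (Re_le_rnorm _) _.
  rewrite rnormM dotC rnormJ; set p := rnorm _; set q := rnorm _.
  rewrite -subr_ge0 (_ : _ - _ = B / 2 * (p - q / B) ^+ 2); last by field; rewrite gt_eqF.
  by apply: mulr_ge0; [rewrite divr_ge0 // ltW | exact: sqr_ge0].
rewrite -mulr_suml big_split /= -!mulr_sumr.
move: vX; rewrite -ler_pdivrMl //; lra.
Qed.

(** By [rnorm_sum_bessel], [B] times the partial sums of |a_k|^2 dominates the squared blocks of the
    series, as [cvgn_sqr_tail] asks. *)
Lemma synthesis_cvg X a : bessel dot X -> square_summable a ->
  series (fun n => a n *: X n) @ \oo --> synthesis X a.
Proof.
move=> [B B0 XB] [K aK]; apply: (@cvgn_sqr_tail _ _ _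
  (fun n => B * \sum_(0 <= k < n) rnorm (a k) ^+ 2) (B * K)) => [n|n m nm].
  by rewrite ler_pM2l.
rewrite sub_series_geq // -mulrBr [X in B * (X - _)](big_cat_nat (n := n)) //=.
rewrite [X in B * X]addrAC subrr add0r.
exact: rnorm_sum_bessel.
Qed.

Lemma synthesisE X a x : series (fun n => a n *: X n) @ \oo --> x -> synthesis X a = x.
Proof. exact/cvg_lim/norm_hausdorff. Qed.

Lemma synthesis_comb X c a b : bessel dot X ->
  square_summable a -> square_summable b ->
  synthesis X (fun n => c * a n + b n) = c *: synthesis X a + synthesis X b.
Proof.
move=> bX la lb; apply: synthesisE.
rewrite (_ : series _ = c \*: series (fun n => a n *: X n) + series (fun n => b n *: X n)).
  by apply: cvgD; [apply: cvgZr|]; exact: synthesis_cvg.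
apply/funext => n; rewrite !fctE /series /= scaler_sumr -big_split /=.
by apply: eq_bigr => k _; rewrite scalerDl scalerA.
Qed.

Lemma synthesis0 X : synthesis X (fun=> 0) = 0.
Proof.
apply: synthesisE; rewrite (_ : series _ = fun=> 0); first exact: cvg_cst.
by apply/funext => n; rewrite /series /= big1 // => k _; rewrite scale0r.
Qed.

Lemma synthesis_continuous (T : H -> H) X a : linear T -> continuous T -> bessel dot X ->
  square_summable a -> synthesis (T \o X) a = T (synthesis X a).
Proof.
move=> lT cT bX la; apply: synthesisE.
have T0 : T 0 = 0.
  by have := lT (-1) 0 0; rewrite !scaleN1r oppr0 addr0 addNr.
have Tsum n : series (fun k => a k *: (T \o X) k) n = T (series (fun k => a k *: X k) n).
  elim: n => [|n IH]; first by rewrite /series /= !big_nil.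
  by rewrite !seriesSr IH [in RHS]addrC lT addrC.
rewrite (funext Tsum); exact: continuous_cvg (cT _) (synthesis_cvg bX la).
Qed.

Lemma rnorm_cvg_le (u : nat -> H) x (K : R) : u @ \oo --> x ->
  (forall n, rnorm (u n) <= K) -> rnorm x <= K.
Proof.
move=> ux uK; apply/ler_addgt0Pr => e e0.
have e0' : 0 < (e%:C%C : R[i]) by rewrite ltcR.
have /cvgrPdist_lt/(_ _ e0')[N _ /(_ N (leqnn N)) /=] := ux.
rewrite rnormE ltcR => xuN; rewrite -(subrK (u N) x).
by apply: le_trans (rnormD _ _) _; rewrite addrC; apply: lerD (uK N) (ltW xuN).
Qed.

Lemma rnorm_synthesis_le X (B : R) a (K : R) : 0 < B ->
  (forall h n, \sum_(0 <= k < n) rnorm (dot h (X k)) ^+ 2 <= B * rnorm h ^+ 2) ->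
  0 <= K -> (forall n, \sum_(0 <= k < n) rnorm (a k) ^+ 2 <= K ^+ 2) ->
  rnorm (synthesis X a) <= Num.sqrt B * K.
Proof.
move=> B0 XB K0 aK.
apply: rnorm_cvg_le (synthesis_cvg _ _) _; [by exists B|by exists (K ^+ 2)|move=> n].
rewrite -ler_sqr ?nnegrE ?mulr_ge0 ?sqrtr_ge0 ?rnorm_ge0 // exprMn sqr_sqrtr ?(ltW B0) //.
apply: le_trans (rnorm_sum_bessel a 0 n B0 XB) _.
by rewrite ler_pM2l.
Qed.

(** Cauchy-Schwarz makes the inner product Lipschitz in its first argument. *)
Lemma dot_cvg (u : nat -> H) x g : u @ \oo --> x ->
  (fun n => dot (u n) g : R[i]^o) @ \oo --> (dot x g : R[i]^o).
Proof.
move=> ux; have ct : continuous (fun y => dot y g : R[i]^o).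
  apply: (@lipschitz_continuous_rnorm _ _ _ _ (rnorm g)) => y z.
  by rewrite -dotBl mulrC; exact: Cauchy_Schwarz.
exact: cvg_comp ux (ct x).
Qed.

Lemma dot_cvgr (u : nat -> H) x g : u @ \oo --> x ->
  (fun n => dot g (u n) : R[i]^o) @ \oo --> (dot g x : R[i]^o).
Proof.
move=> ux; have ct : continuous (fun y => dot g y : R[i]^o).
  apply: (@lipschitz_continuous_rnorm _ _ _ _ (rnorm g)) => y z.
  by rewrite -dotBr; exact: Cauchy_Schwarz.
exact: cvg_comp ux (ct x).
Qed.

Lemma dot_synthesis_cvg X a g : bessel dot X -> square_summable a ->
  (series (fun n => a n * dot (X n) g) : nat -> R[i]^o) @ \oo
    --> (dot (synthesis X a) g : R[i]^o).
Proof.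
move=> bX la; rewrite (_ : series _ = fun n => dot (series (fun n => a n *: X n) n) g).
  exact/dot_cvg/synthesis_cvg.
apply/funext => n; rewrite /series /= linear_sumlz.
apply: eq_bigr => k _; exact/esym/dotZl.
Qed.

End Synthesis.

(** * Coercive operators *)

Lemma Re_cvg_le {R : realType} (u : nat -> R[i]) (z : R[i]) (K : R) (n0 : nat) :
  (u : nat -> R[i]^o) @ \oo --> (z : R[i]^o) ->
  (forall n, (n0 <= n)%N -> complex.Re (u n) <= K) -> complex.Re z <= K.
Proof.
move=> uz uK; apply/ler_addgt0Pr => e e0.
have e0' : 0 < (e%:C%C : R[i]) by rewrite ltcR.
have /cvgrPdist_lt/(_ _ e0')[N _ /(_ (maxn n0 N) (leq_maxr _ _)) /=] := uz.
rewrite rnormE ltcR => zN; rewrite -(subrK (u (maxn n0 N)) z) ReD addrC.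
by apply: lerD (uK _ (leq_maxl _ _)) (le_trans (Re_le_rnorm _) (ltW zN)).
Qed.

(** The threshold [n0] serves monotone partial sums: the sum of length n bounds only the later ones
    from below. *)
Lemma Re_cvg_ge {R : realType} (u : nat -> R[i]) (z : R[i]) (K : R) (n0 : nat) :
  (u : nat -> R[i]^o) @ \oo --> (z : R[i]^o) ->
  (forall n, (n0 <= n)%N -> K <= complex.Re (u n)) -> K <= complex.Re z.
Proof.
have ReN (w : R[i]) : complex.Re (- w) = - complex.Re w by case: w.
move=> uz uK; rewrite -lerN2 -ReN.
apply: (@Re_cvg_le _ (fun n => - u n) _ _ n0); first exact: (@cvgN _ R[i]^o).
by move=> n /uK; rewrite ReN lerN2.
Qed.

Section Operators.
Context {R : realType} {H : completeNormedModType R[i]} {dot : {dot H for Num.conj}}.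
Hypothesis Hdot : induces_norm dot.
Implicit Types (x y h g : H) (X Y : nat -> H) (T : H -> H).

Lemma inverseK T : bijective T -> cancel T (inverse T).
Proof.
by move=> /bij_inj Ti x; rewrite /inverse pinvKV ?inE // => y z _ _; exact: Ti.
Qed.

Lemma inverseKV T : bijective T -> cancel (inverse T) T.
Proof.
move=> [T' _ T'K] x; rewrite /inverse pinvK // inE; exists (T' x) => //.
Qed.

Lemma inverse_unique T T' : bijective T -> (forall x, T (T' x) = x) -> inverse T = T'.
Proof.
by move=> bT TT'; apply/funext => x; rewrite -{1}(TT' x) inverseK.
Qed.

Lemma linear_inverse T : linear T -> bijective T -> linear (inverse T).
Proof.
move=> lT bT c x y; apply: (bij_inj bT).
by rewrite lT !inverseKV.
Qed.

Lemma linear_mapB T : linear T -> {morph T : x y / x - y}.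
Proof. by move=> lT x y; rewrite addrC -scaleN1r lT scaleN1r addrC. Qed.

Lemma linear_mapZ T : linear T -> forall k, {morph T : x / k *: x}.
Proof.
move=> lT k x; have := linear_mapB lT 0 0; rewrite !subrr => T0.
by rewrite -[k *: x]addr0 lT T0 addr0.
Qed.

Lemma linear_rnorm_continuous T (C : R) : linear T ->
  (forall x, rnorm (T x) <= C * rnorm x) -> continuous T.
Proof.
move=> lT TC; apply: (@lipschitz_continuous_rnorm _ _ _ _ C) => x y.
by rewrite -linear_mapB.
Qed.

(* The fixed points of [x - t (T x - y)] solve [T x = y], and the map is a contraction for
   [t = A / D^2] as soon as [D >= C] and [D >= A]. *)
Lemma coercive_bijective T (A C : R) : linear T -> 0 < A ->
  (forall x, rnorm (T x) <= C * rnorm x) ->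
  (forall x, A * rnorm x ^+ 2 <= complex.Re (dot (T x) x)) -> bijective T.
Proof.
move=> lT A0 TC TA.
have TB := linear_mapB lT.
have Tinj : injective T.
  move=> x y Txy; apply/eqP; rewrite -subr_eq0; apply/eqP/rnorm_eq0.
  have := TA (x - y); rewrite TB Txy subrr dot0l /= pmulr_rle0 // => w0.
  by apply/eqP; rewrite -sqrf_eq0 eq_le w0 sqr_ge0.
pose D := Num.max A C; have AD : A <= D by rewrite le_max lexx.
have D0 : 0 < D := lt_le_trans A0 AD.
have TD x : rnorm (T x) <= D * rnorm x.
  by apply: le_trans (TC x) _; rewrite ler_wpM2r ?rnorm_ge0 // le_max lexx orbT.
pose r := A / D; have r0 : 0 < r by rewrite divr_gt0.
have r1 : r <= 1 by rewrite ler_pdivrMr ?mul1r.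
pose t := r / D; have t0 : 0 < t by rewrite divr_gt0.
have tA : t * A = r ^+ 2 by rewrite /t /r; field; rewrite gt_eqF.
have tD : t * D = r by rewrite /t divfK ?gt_eqF.
have Tsurj y : exists x, T x = y.
  pose F x := x - t%:C%C *: T x + t%:C%C *: y.
  have FB x z : F x - F z = (x - z) - t%:C%C *: T (x - z).
    rewrite /F TB scalerBr [in LHS]opprD addrACA subrr addr0.
    by rewrite [in LHS]opprD opprK addrACA [in RHS]opprD opprK.
  have Fq x z : rnorm (F x - F z) <= (1 - r ^+ 2 / 2) * rnorm (x - z).
    rewrite FB; move: (x - z) => w.
    have q0 : 0 <= 1 - r ^+ 2 / 2 by nra.
    rewrite -ler_sqr ?nnegrE ?mulr_ge0 ?rnorm_ge0 //.
    rewrite (rnorm_sqrB Hdot) rnormZ rnorm_real ?(ltW t0) //.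
    have -> : dot w (t%:C%C *: T w) = t%:C%C * dot w (T w).
      by rewrite dotZr; congr (_ * _); exact: conjc_real.
    rewrite Re_realM (_ : complex.Re (dot w (T w)) = complex.Re (dot (T w) w)); last first.
      by rewrite dotC; case: (dot _ _).
    (* Since t A = r^2 and t D = r, |w - t T w|^2 <= (1 - 2 r^2 + r^2) |w|^2, and 1 - r^2 <= (1 -
       r^2 / 2)^2. *)
    have h1 : t * (A * rnorm w ^+ 2) <= t * complex.Re (dot (T w) w) by rewrite ler_pM2l.
    have h2 : (t * rnorm (T w)) ^+ 2 <= (r * rnorm w) ^+ 2.
      rewrite ler_sqr; first by rewrite -tD -mulrA ler_pM2l.
        by rewrite nnegrE; apply: mulr_ge0 (ltW t0) (rnorm_ge0 _).
      by rewrite nnegrE; apply: mulr_ge0 (ltW r0) (rnorm_ge0 _).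
    rewrite mulrA tA in h1; rewrite exprMn in h2.
    have h3 : 0 <= (r ^+ 2) ^+ 2 * rnorm w ^+ 2 by rewrite mulr_ge0 ?sqr_ge0.
    move: h1 h2 h3; rewrite [X in _ -> _ -> _ -> _ <= X]exprMn.
    lra.
  have [|x] := @contraction_fixpoint _ _ F (1 - r ^+ 2 / 2) _ Fq.
    by apply/andP; split; nra.
  rewrite /F -addrA -[RHS]addr0 => /addrI /eqP.
  rewrite addrC -scalerBr scaler_eq0 subr_eq0 => /orP[|/eqP]; last by exists x.
  by rewrite (inj_eq (@complexI R)) gt_eqF.
have [T' T'K] := choice Tsurj; exists T' => // x; exact: Tinj.
Qed.
End Operators.

(** * Frame operators and canonical duals *)

Section Frames.
Context {R : realType} {H : completeNormedModType R[i]} {dot : {dot H for Num.conj}}.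
Hypothesis Hdot : induces_norm dot.
Implicit Types (x y h g : H) (X Y : nat -> H) (T : H -> H) (c : R[i]).

(** The frame operator of [X] is convertible to the case [Y = X]. *)
Definition mixed_operator (dot : {dot H for Num.conj}) X Y : H -> H :=
  fun h => synthesis X (fun n => dot h (Y n)).

Local Notation bessel := (bessel dot).
Local Notation D := (mixed_operator dot).

Lemma mixed_linear X Y : bessel X -> bessel Y -> linear (D X Y).
Proof.
move=> bX bY c x y; rewrite -(synthesis_comb Hdot) //; try exact: bessel_analysis.
by congr synthesis; apply/funext => n; rewrite dotDl dotZl.
Qed.

Lemma mixed_bounded X Y : bessel X -> bessel Y ->
  exists C : R, forall h, rnorm (D X Y h) <= C * rnorm h.
Proof.
move=> [B B0 XB] [C C0 YC]; exists (Num.sqrt B * Num.sqrt C) => h.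
rewrite -mulrA; apply: rnorm_synthesis_le => // [|n].
  by rewrite mulr_ge0 ?sqrtr_ge0 ?rnorm_ge0.
by rewrite exprMn sqr_sqrtr ?(ltW C0).
Qed.

Lemma mixed_cvg X Y h : bessel X -> bessel Y ->
  series (fun n => dot h (Y n) *: X n) @ \oo --> D X Y h.
Proof. by move=> bX bY; apply: synthesis_cvg => //; exact: bessel_analysis. Qed.

Lemma dot_mixed_cvg X Y h g : bessel X -> bessel Y ->
  (series (fun n => dot h (Y n) * dot (X n) g) : nat -> R[i]^o) @ \oo
    --> (dot (D X Y h) g : R[i]^o).
Proof.
by move=> bX bY; apply: dot_synthesis_cvg => //; exact: bessel_analysis.
Qed.

(** Both sides are limits of the partial sums of <h, Y_n> <X_n, g>. *)
Lemma mixed_adjoint X Y h g : bessel X -> bessel Y ->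
  dot (D X Y h) g = dot h (D Y X g).
Proof.
move=> bX bY; have := @dot_mixed_cvg X Y h g bX bY.
have := dot_cvgr Hdot (g := h) (@mixed_cvg Y X g bY bX).
rewrite (_ : (fun n => _) = series (fun n => dot h (Y n) * dot (X n) g)).
  by move=> l1 l2; apply: (cvg_unique (@norm_hausdorff _ R[i]^o) l2 l1).
apply/funext => n; rewrite /series /= linear_sumr; apply: eq_bigr => k _.
rewrite [LHS]dotZr mulrC; congr (_ * _); exact/esym/dotC.
Qed.

Lemma multiplierE c X Y : bessel X -> bessel Y ->
  multiplier dot (fun=> c) X Y = (fun h => c *: D X Y h).
Proof.
(* Adding the synthesis of the zero sequence brings the right side to the shape c a + b of
   [synthesis_comb]. *)
move=> bX bY; apply/funext => h; rewrite -[RHS]addr0 -(synthesis0 X).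
rewrite -(synthesis_comb Hdot) //; [|exact: bessel_analysis|].
  by congr synthesis; apply/funext => n; rewrite addr0.
by apply: (@square_summable_finite _ _ 0).
Qed.

Lemma frame_bessel X : is_frame dot X -> bessel X.
Proof.
move=> [A [B [A0 AB XB]]]; exists B => [|h n]; first exact: lt_le_trans A0 AB.
have [_ uB] := XB h; rewrite -lee_fin; apply: le_trans uB.
rewrite -sumEFin; apply: nneseries_lim_ge => k _ _.
by rewrite lee_fin sqr_ge0.
Qed.

Lemma Re_dot_series X h n :
  complex.Re (series (fun k => dot h (X k) * dot (X k) h) n) =
  \sum_(0 <= k < n) rnorm (dot h (X k)) ^+ 2.
Proof.
rewrite /series /= Re_sum; apply: eq_bigr => k _.
by rewrite [dot (X k) h]dotC mul_conj_rnorm.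
Qed.

(** The real parts of the partial sums of <S h, h> are the nondecreasing sums of |<h, X_k>|^2, so
    each of them, and hence the frame sum, is at most Re <S h, h>. *)
Lemma frame_coercive X : is_frame dot X ->
  exists2 A : R, 0 < A & forall h, A * rnorm h ^+ 2 <= complex.Re (dot (D X X h) h).
Proof.
move=> fX; have bX := frame_bessel fX; case: fX => A [B [A0 _ XA]].
exists A => // h; rewrite -lee_fin; apply: le_trans (XA h).1 _.
apply: lime_le; first by apply: is_cvg_nneseries => n _ _; rewrite lee_fin sqr_ge0.
apply: nearW => n; rewrite sumEFin lee_fin.
apply: (Re_cvg_ge (n0 := n) (@dot_mixed_cvg _ _ h h bX bX)) => m nm.
rewrite Re_dot_series [leRHS](big_cat_nat (n := n)) //= lerDl.
by apply: sumr_ge0 => k _; exact: sqr_ge0.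
Qed.

(* [|h|^2 = sum <h,Y_n><X_n,h>], and Young's inequality weighted by the Bessel bound of [X]
   gives the lower frame bound of [Y]. *)
Lemma reproducing_frame X Y : bessel X -> bessel Y -> (forall h, D X Y h = h) ->
  is_frame dot Y.
Proof.
move=> bX bY XY; have [B B0 XB] := bX; have [C C0 YC] := bY.
(* The maximum secures the clause A <= B of [is_frame]. *)
exists B^-1, (Num.max B^-1 C); split; rewrite ?invr_gt0 ?le_max ?lexx // => h.
set s := (\sum_(0 <= n <oo) _)%E.
have s_ge n : ((\sum_(0 <= k < n) rnorm (dot h (Y k)) ^+ 2)%:E <= s)%E.
  rewrite -sumEFin; apply: nneseries_lim_ge => k _ _.
  by rewrite lee_fin sqr_ge0.
have s_le : (s <= (C * rnorm h ^+ 2)%:E)%E.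
  apply: lime_le; first by apply: is_cvg_nneseries => n _ _; rewrite lee_fin sqr_ge0.
  by apply: nearW => n; rewrite sumEFin lee_fin.
split; last first.
  apply: le_trans s_le _; rewrite lee_fin ler_wpM2r ?sqr_ge0 //.
  by rewrite le_max lexx orbT.
(* The Bessel bound of [Y] rules out +oo, and the empty partial sum rules out -oo. *)
have [L sL] : exists L : R, s = L%:E.
  have := s_ge 0; move: s_le; case: (s) => [L _ _| |]; last 1 first.
  - by rewrite leeNy_eq.
  - by exists L.
  - by rewrite leye_eq.
rewrite sL in s_ge *; rewrite lee_fin ler_pdivrMl //.
have : complex.Re (dot (D X Y h) h) <= (B * L + rnorm h ^+ 2) / 2.
  apply: (Re_cvg_le (n0 := 0) (@dot_mixed_cvg _ _ h h bX bY)) => n _.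
  rewrite Re_sum; apply: (@le_trans _ _ (\sum_(0 <= k < n)
    (B * rnorm (dot h (Y k)) ^+ 2 + B^-1 * rnorm (dot h (X k)) ^+ 2) / 2)).
    apply: ler_sum => k _; apply: le_trans (Re_le_rnorm _) _.
    rewrite rnormM [dot (X k) h]dotC rnormJ; set p := rnorm _; set q := rnorm _.
    rewrite -subr_ge0 (_ : _ - _ = B / 2 * (p - q / B) ^+ 2); last by field; rewrite gt_eqF.
    by apply: mulr_ge0; [rewrite divr_ge0 // ltW | exact: sqr_ge0].
  rewrite -mulr_suml big_split /= -!mulr_sumr ler_pM2r ?invr_gt0 //.
  by apply: lerD; [rewrite ler_pM2l // -lee_fin | rewrite ler_pdivrMl].
rewrite XY (dot_rnorm Hdot) /=; lra.
Qed.

Lemma dual_frame_of X Y : bessel X -> bessel Y -> (forall h, D X Y h = h) ->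
  is_dual_frame dot X Y.
Proof.
move=> bX bY XY; split=> [|h]; first exact: reproducing_frame XY.
by rewrite -[X in _ --> X]XY; exact: mixed_cvg.
Qed.

Lemma dual_frame_bessel X Y : is_dual_frame dot X Y -> bessel Y.
Proof. by case=> /frame_bessel. Qed.

Lemma dual_frameE X Y h : is_dual_frame dot X Y -> D X Y h = h.
Proof. by case=> _ /(_ h) /synthesisE. Qed.

(** [D Y X] is the adjoint of [D X Y], which is the identity. *)
Lemma dual_frameEC X Y h : bessel X -> is_dual_frame dot X Y -> D Y X h = h.
Proof.
move=> bX dXY; have bY := dual_frame_bessel dXY.
by apply: (dot_inj (dot := dot)) => g; rewrite mixed_adjoint // dual_frameE.
Qed.

Section CanonicalDual.
Variable X : nat -> H.
Hypothesis fX : is_frame dot X.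
Let bX := frame_bessel fX.
Local Notation S := (D X X).
Local Notation S' := (inverse (frame_operator dot X)).

Lemma frame_operator_bij : bijective S.
Proof.
have [A A0 XA] := frame_coercive fX; have [C DC] := mixed_bounded bX bX.
exact: coercive_bijective (mixed_linear bX bX) A0 DC XA.
Qed.

Lemma frame_operatorK : cancel S S'.
Proof. exact: inverseK frame_operator_bij. Qed.

Lemma frame_operatorKV : cancel S' S.
Proof. exact: inverseKV frame_operator_bij. Qed.

Lemma frame_inverse_linear : linear S'.
Proof. exact: linear_inverse (mixed_linear bX bX) frame_operator_bij. Qed.

(** Coercivity at [S' h] and Cauchy-Schwarz give A |S' h|^2 <= |h| |S' h|; cancelling |S' h| leaves
    the bound 1/A. *)
Lemma frame_inverse_bounded : exists C : R, forall h, rnorm (S' h) <= C * rnorm h.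
Proof.
have [A A0 XA] := frame_coercive fX; exists A^-1 => h.
rewrite ler_pdivlMl //; have := XA (S' h); rewrite frame_operatorKV => Ah.
have [->|n0] := eqVneq (rnorm (S' h)) 0; first by rewrite mulr0 rnorm_ge0.
have n1 : 0 < rnorm (S' h) by rewrite lt_def n0 rnorm_ge0.
rewrite -(ler_pM2r n1) -mulrA -expr2; apply: le_trans Ah _.
exact: le_trans (Re_le_rnorm _) (Cauchy_Schwarz Hdot _ _).
Qed.

Lemma frame_inverse_continuous : continuous S'.
Proof.
have [C SC] := frame_inverse_bounded.
exact: linear_rnorm_continuous frame_inverse_linear SC.
Qed.

Lemma frame_inverse_selfadjoint x y : dot (S' x) y = dot x (S' y).
Proof. by rewrite -{1}(frame_operatorKV y) -mixed_adjoint // frame_operatorKV. Qed.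

Lemma canonical_dual_bessel : bessel (canonical_dual dot X).
Proof.
have [B B0 XB] := bX; have [C SC] := frame_inverse_bounded.
(* The summand 1 keeps the Bessel bound positive when [C] is zero. *)
exists (B * (C ^+ 2 + 1)) => [|h n].
  by rewrite mulr_gt0 // ltr_wpDl ?sqr_ge0.
under eq_bigr do rewrite /canonical_dual -frame_inverse_selfadjoint.
apply: le_trans (XB _ _) _; rewrite -mulrA ler_pM2l //.
have sC : rnorm (S' h) ^+ 2 <= (C * rnorm h) ^+ 2.
  by rewrite ler_sqr ?nnegrE ?rnorm_ge0 ?(le_trans (rnorm_ge0 _) (SC h)).
by apply: le_trans sC _; rewrite exprMn mulrDl mul1r lerDl sqr_ge0.
Qed.

Lemma mixed_canonical_dualr Y h : D Y (canonical_dual dot X) h = D Y X (S' h).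
Proof.
by congr synthesis; apply/funext => n; rewrite frame_inverse_selfadjoint.
Qed.

Lemma mixed_canonical_duall Y h : bessel Y ->
  D (canonical_dual dot X) Y h = S' (D X Y h).
Proof.
move=> bY; apply: synthesis_continuous => //.
- exact: frame_inverse_linear.
- exact: frame_inverse_continuous.
- exact: bessel_analysis.
Qed.

Lemma canonical_dual_frame : is_dual_frame dot X (canonical_dual dot X).
Proof.
apply: dual_frame_of (canonical_dual_bessel) _ => // h.
by rewrite mixed_canonical_dualr frame_operatorKV.
Qed.

End CanonicalDual.
End Frames.

(** * Equality of analysis coefficients and separation by dual frames *)

Section Duals.
Context {R : realType} {H : completeNormedModType R[i]} {dot : {dot H for Num.conj}}.
Hypothesis Hdot : induces_norm dot.
Implicit Types (x y h g : H) (X Y U V : nat -> H) (a : nat -> R[i]).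

Local Notation bessel := (bessel dot).
Local Notation D := (mixed_operator dot).

(* For [w = <x,X_n> - <y,Y_n>], the sum of [w_n conj(w_n)] is
   [<synthesis X w, x> - <synthesis Y w, y> = 0]. *)
Lemma eq_analysis X Y x y : bessel X -> bessel Y ->
  D X X x = D X Y y -> D Y X x = D Y Y y -> forall n, dot x (X n) = dot y (Y n).
Proof.
move=> bX bY eX eY n; pose w n := - 1 * dot y (Y n) + dot x (X n).
have lX := bessel_analysis x bX; have lY := bessel_analysis y bY.
have lw : square_summable w by exact: square_summable_comb.
have wX : synthesis X w = 0.
  rewrite (synthesis_comb Hdot) // -[synthesis X _]/(D X Y y) -[X in _ + X]/(D X X x).
  by rewrite eX scaleN1r addNr.
have wY : synthesis Y w = 0.
  rewrite (synthesis_comb Hdot) // -[synthesis Y _]/(D Y Y y) -[X in _ + X]/(D Y X x).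
  by rewrite eY scaleN1r addNr.
have cX := @dot_synthesis_cvg _ _ _ Hdot X w x bX lw.
have cY := @dot_synthesis_cvg _ _ _ Hdot Y w y bY lw.
rewrite wX dot0l in cX; rewrite wY dot0l in cY.
have := @cvgB _ R[i]^o _ _ _ _ _ _ _ cX cY; rewrite subrr => /(_ _) cw.
have wE m : complex.Re (series (fun n => w n * dot (X n) x) m
    - series (fun n => w n * dot (Y n) y) m) = \sum_(0 <= k < m) rnorm (w k) ^+ 2.
  rewrite /series /= -sumrB Re_sum; apply: eq_bigr => k _.
  rewrite -mulrBr -[RHS]/(complex.Re (rnorm (w k) ^+ 2)%:C%C) -mul_conj_rnorm.
  by rewrite [dot (X k) x]dotC [dot (Y k) y]dotC -rmorphB /w mulN1r [- _ + _]addrC.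
have : rnorm (w n) ^+ 2 <= complex.Re (0 : R[i]).
  apply: (@Re_cvg_ge _ _ _ _ n.+1 cw) => m nm; rewrite [leRHS]wE.
  rewrite (bigD1_seq n) ?mem_index_iota ?iota_uniq //= lerDl.
  by apply: sumr_ge0 => k _; exact: sqr_ge0.
rewrite /= => wn0; have /rnorm_eq0 : rnorm (w n) = 0.
  by apply/eqP; rewrite -sqrf_eq0 eq_le wn0 sqr_ge0.
by rewrite /w mulN1r addrC => /eqP; rewrite subr_eq0 => /eqP.
Qed.

Lemma synthesis_delta X k : synthesis X (fun n => (n == k)%:R) = X k.
Proof.
apply: synthesisE; apply: cvg_near_cst; exists k.+1 => // n /= kn.
rewrite /series /= (bigD1_seq k) ?mem_index_iota ?iota_uniq //= eqxx scale1r.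
by rewrite big1 ?addr0 // => i /negPf ->; rewrite scale0r.
Qed.

(** The conjugate offsets the conjugate-linearity of the second argument: <h, X_n + conj(a_n) g> =
    <h, X_n> + a_n <h, g>. *)
Lemma bessel_perturbation X a g : bessel X -> square_summable a ->
  bessel (fun n => X n + (a n)^*%R *: g).
Proof.
move=> [B B0 XB] [K aK]; have K0 : 0 <= K by have := aK 0; rewrite big_nil.
exists (2 * (B + K * rnorm g ^+ 2)) => [|h n].
  by rewrite mulr_gt0 // ltr_wpDr // mulr_ge0 ?sqr_ge0.
apply: (@le_trans _ _ (\sum_(0 <= k < n)
    2 * (rnorm (dot h (X k)) ^+ 2 + rnorm (a k) ^+ 2 * rnorm (dot h g) ^+ 2))).
  apply: ler_sum => k _; rewrite dotDr dotZr conjCK -exprMn -rnormM.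
  exact: rnorm_sqrD.
rewrite -mulr_sumr big_split /= -mulr_suml -mulrA ler_pM2l // mulrDl.
apply: lerD (XB _ _) _; rewrite -mulrA.
apply: ler_pM => //; rewrite ?sqr_ge0 //.
  by apply: sumr_ge0 => k _; exact: sqr_ge0.
rewrite -exprMn ler_sqr ?nnegrE ?mulr_ge0 ?rnorm_ge0 // mulrC.
exact: Cauchy_Schwarz.
Qed.

(* Any [a] with [synthesis X a = 0] perturbs the canonical dual of [X] to another dual
   frame; take [a] to be the k-th unit sequence minus the coefficients of [X k]. *)
Lemma mixed_dual_inj X U V : is_frame dot X -> bessel U -> bessel V ->
  (forall Xd, is_dual_frame dot X Xd -> D U Xd = D V Xd) -> U = V.
Proof.
move=> fX bU bV UV; apply/funext => k; have bX := frame_bessel fX.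
pose C := canonical_dual dot X.
have dC : is_dual_frame dot X C := canonical_dual_frame Hdot fX.
have bC := dual_frame_bessel dC.
pose b n := dot (X k) (C n).
have lb : square_summable b := bessel_analysis (X k) bC.
have ld : square_summable (fun n => (n == k)%:R : R[i]).
  apply: (@square_summable_finite _ _ k.+1) => n kn.
  by rewrite (gtn_eqF kn).
pose a n := - 1 * b n + (n == k)%:R.
have la : square_summable a := square_summable_comb _ lb ld.
have aE W : bessel W -> synthesis W a = - D W C (X k) + W k.
  by move=> bW; rewrite (synthesis_comb Hdot) // synthesis_delta scaleN1r.
(* The perturbation runs along the difference that must vanish: equality of [D U Xd] and [D V Xd] at
   [g] becomes <g, g> g = 0. *)
pose g := synthesis U a - synthesis V a.
pose Xd n := C n + (a n)^*%R *: g.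
have bXd : bessel Xd by exact: bessel_perturbation.
have XdE W h : bessel W -> D W Xd h = dot h g *: synthesis W a + D W C h.
  move=> bW; rewrite -(synthesis_comb Hdot) //; last exact: bessel_analysis.
  by congr synthesis; apply/funext => n; rewrite dotDr dotZr conjCK addrC mulrC.
have dXd : is_dual_frame dot X Xd.
  apply: dual_frame_of => // h; rewrite XdE // aE // !dual_frameE //.
  by rewrite addNr scaler0 add0r.
have g0 : g = 0.
  have := congr1 (@^~ g) (UV _ dXd); rewrite !XdE // (UV _ dC) => /addIr/eqP.
  rewrite -subr_eq0 -scalerBr -/g scaler_eq0 dnorm_eq0 orbb => /eqP //.
move/eqP: g0; rewrite subr_eq0 !aE // (UV _ dC) => /eqP; exact: addrI.
Qed.

End Duals.

(** * Equivalent frames and multipliers *)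

Section EquivalentFrames.
Context {R : realType} {H : completeNormedModType R[i]} {dot : {dot H for Num.conj}}.
Hypothesis Hdot : induces_norm dot.
Variables (Phi Psi : nat -> H) (c : R[i]).
Hypotheses (fPhi : is_frame dot Phi) (fPsi : is_frame dot Psi) (c0 : c != 0).

Let bPhi := frame_bessel fPhi.
Let bPsi := frame_bessel fPsi.
Local Notation D := (mixed_operator dot).
Local Notation M := (multiplier dot (fun=> c) Phi Psi).
Local Notation SPhi' := (inverse (frame_operator dot Phi)).
Local Notation SPsi' := (inverse (frame_operator dot Psi)).

Lemma mixedZ X Y k h : bessel dot X -> bessel dot Y -> D X Y (k *: h) = k *: D X Y h.
Proof.
by move=> bX bY; exact: linear_mapZ (mixed_linear Hdot bX bY) _ _.
Qed.

Lemma multiplier_canonical_equivalent : bijective M ->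
  inverse M = multiplier dot (fun=> c^-1) (canonical_dual dot Psi) (canonical_dual dot Phi) ->
  equivalent_frames Phi Psi.
Proof.
move=> bM; rewrite [multiplier _ (fun=> c^-1) _ _]multiplierE //; try exact: canonical_dual_bessel.
move=> iM; pose T h := SPsi' (D Psi Phi h).
have iME h : inverse M h = c^-1 *: T (SPhi' h).
  by rewrite iM mixed_canonical_dualr // mixed_canonical_duall.
have ME h : M h = c *: D Phi Psi h by rewrite multiplierE.
have DT h : D Phi Psi (T (SPhi' h)) = h.
  have := inverseKV bM h; rewrite ME iME mixedZ // scalerA mulfV // scale1r; exact.
have DT' h : T (SPhi' (D Phi Psi h)) = h.
  have := inverseK bM (c^-1 *: h); rewrite iME ME mixedZ // scalerA mulfV // scale1r.
  by move/(scalerI (invr_neq0 c0)).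
(* Paired with [h], this says <T h, Psi_n> = <h, Phi_n>; [DT] at S_Phi h and the definition of [T]
   supply the two conditions of [eq_analysis]. *)
have PhiE n : D Phi Psi (SPsi' (Psi n)) = Phi n.
  apply: (dot_inj (dot := dot)) => h; rewrite dotC [RHS]dotC; congr (_^*)%R.
  rewrite -mixed_adjoint // -frame_inverse_selfadjoint //; apply/esym.
  apply: eq_analysis => //; last by rewrite frame_operatorKV.
  by rewrite -[in RHS](frame_operatorK Hdot fPhi h) DT.
pose G h := D Psi Phi (SPhi' h).
(* By [DT'], u = T (S_Phi^-1 (D Phi Psi u)), and applying S_Psi cancels the S_Psi^-1 inside [T]. *)
have GD u : G (D Phi Psi u) = D Psi Psi u.
  by rewrite -[in RHS](DT' u) frame_operatorKV.
exists G => [|n]; last first.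
  by rewrite -[in RHS]PhiE GD frame_operatorKV.
split.
- move=> k x y; rewrite /G frame_inverse_linear //; exact: mixed_linear.
- have [C1 h1] := mixed_bounded Hdot bPsi bPhi.
  have [C2 h2] := frame_inverse_bounded Hdot fPhi.
  exists (`|C1| * C2) => h; apply: le_trans (h1 _) _.
  apply: (@le_trans _ _ (`|C1| * rnorm (SPhi' h))).
    by rewrite ler_wpM2r ?rnorm_ge0 // ler_norm.
  by rewrite -mulrA ler_wpM2l.
- exists (D Phi Psi \o SPsi') => h /=; first exact: DT.
  by rewrite GD frame_operatorKV.
Qed.

Section ByOperator.
Variable G : H -> H.
Hypotheses (iG : invertible G) (PsiE : forall n, Psi n = G (Phi n)).

(** [G] is linear and bounded, so it passes through the synthesis series. *)
Lemma mixed_equivalent Y h : bessel dot Y -> D Psi Y h = G (D Phi Y h).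
Proof.
case: iG => lG [C GC] _ bY; have -> : Psi = G \o Phi by apply/funext.
apply: (synthesis_continuous Hdot) => //; last exact: bessel_analysis.
exact: linear_rnorm_continuous GC.
Qed.

(** Injectivity of [G] reduces the claim to its image under [G], where [D Phi Psi] becomes S_Psi and
    cancels S_Psi^-1. *)
Lemma multiplier_rightinv h : M (c^-1 *: SPsi' (G h)) = h.
Proof.
have [lG _ bG] := iG; rewrite multiplierE // mixedZ // scalerA mulfV //.
rewrite scale1r; apply: (bij_inj bG).
by rewrite -mixed_equivalent // frame_operatorKV.
Qed.

Lemma multiplier_invertible : invertible M.
Proof.
split.
- move=> k x y; rewrite multiplierE // (mixed_linear Hdot bPhi bPsi).
  by rewrite scalerDr !scalerA mulrC.
- have [C MC] := mixed_bounded Hdot bPhi bPsi.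
  exists (rnorm c * C) => h; rewrite multiplierE // rnormZ -mulrA.
  by rewrite ler_wpM2l ?rnorm_ge0.
- exists (fun h => c^-1 *: SPsi' (G h)) => h; last exact: multiplier_rightinv.
  have [lG _ _] := iG.
  rewrite multiplierE //.
  rewrite (linear_mapZ lG) (linear_mapZ (frame_inverse_linear Hdot fPsi)).
  by rewrite -mixed_equivalent // frame_operatorK // scalerA mulVf // scale1r.
Qed.

Lemma inverse_multiplier : inverse M = (fun h => c^-1 *: SPsi' (G h)).
Proof.
by apply: inverse_unique multiplier_rightinv; case: multiplier_invertible.
Qed.

(** S_Psi^-1 (D Psi Phi^d) = S_Psi^-1 G (D Phi Phi^d) = S_Psi^-1 G. *)
Lemma inverse_multiplier_duall Phid : is_dual_frame dot Phi Phid ->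
  inverse M = multiplier dot (fun=> c^-1) (canonical_dual dot Psi) Phid.
Proof.
move=> dPhi; have bPhid := dual_frame_bessel dPhi.
rewrite inverse_multiplier multiplierE //; last exact: canonical_dual_bessel.
apply/funext => h.
by rewrite mixed_canonical_duall // mixed_equivalent // dual_frameE.
Qed.

Lemma inverse_multiplier_dualr Psid : is_dual_frame dot Psi Psid ->
  inverse M = multiplier dot (fun=> c^-1) Psid (canonical_dual dot Phi).
Proof.
move=> dPsi; have bPsid := dual_frame_bessel dPsi; have [_ _ bG] := iG.
rewrite inverse_multiplier multiplierE //; last exact: canonical_dual_bessel.
have MPhi n : D Phi Psi (SPsi' (Psi n)) = Phi n.
  by apply: (bij_inj bG); rewrite -mixed_equivalent // frame_operatorKV.
(* The coefficients of [g] against [Phi] are those of another vector against [Psi], so every dual of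
   [Psi] recovers that same vector. *)
have PhiE g n : dot g (Phi n) = dot (SPsi' (D Psi Phi g)) (Psi n).
  by rewrite frame_inverse_selfadjoint // mixed_adjoint // MPhi.
apply/funext => h; congr (_ *: _); rewrite mixed_canonical_dualr //.
rewrite /mixed_operator (funext (PhiE _)) -[RHS]/(D Psid Psi _) dual_frameEC //.
by rewrite mixed_equivalent // frame_operatorKV.
Qed.

End ByOperator.
End EquivalentFrames.

Theorem theorem4p6 (R : realType) (H : completeNormedModType R[i])
    (dot : {dot H for Num.conj}) (Hdot : induces_norm dot)
    (Hsep : separable H) (Phi Psi : nat -> H) (c : R[i])
    (HPhi : is_frame dot Phi) (HPsi : is_frame dot Psi) (Hc : c <> 0) :
  let M := multiplier dot (fun=> c) Phi Psi in
  let Mc (X Y : nat -> H) := multiplier dot (fun=> c^-1) X Y in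
  [<-> (* (a) *)
       invertible M /\
       inverse M = Mc (canonical_dual dot Psi) (canonical_dual dot Phi) ;
       (* (b) *)
       equivalent_frames Phi Psi ;
       (* (c1) *)
       invertible M /\
       unique (fun Psidag => is_dual_frame dot Psi Psidag /\
                 forall Phid, is_dual_frame dot Phi Phid ->
                   inverse M = Mc Psidag Phid)
              (canonical_dual dot Psi) ;
       (* (c2) *)
       invertible M /\
       unique (fun Phidag => is_dual_frame dot Phi Phidag /\
                 forall Psid, is_dual_frame dot Psi Psid ->
                   inverse M = Mc Psid Phidag)
              (canonical_dual dot Phi) ;
       (* (d1) *)
       invertible M /\
       (forall Phid, is_dual_frame dot Phi Phid ->
          inverse M = Mc (canonical_dual dot Psi) Phid) ;
       (* (d2) *)
       invertible M /\
       (forall Psid, is_dual_frame dot Psi Psid ->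
          inverse M = Mc Psid (canonical_dual dot Phi)) ].
Proof.
move=> M Mc; have /eqP c0 := Hc.
have bPhi := frame_bessel HPhi; have bPsi := frame_bessel HPsi.
have dPhi := canonical_dual_frame Hdot HPhi.
have dPsi := canonical_dual_frame Hdot HPsi.
(* The factor 1/c is nonzero, so equal multipliers have equal mixed operators, the form that
   [mixed_dual_inj] expects. *)
have McE X X' Y Y' : bessel dot X -> bessel dot X' -> bessel dot Y -> bessel dot Y' ->
    Mc X Y = Mc X' Y' -> mixed_operator dot X Y = mixed_operator dot X' Y'.
  move=> bX bX' bY bY'; rewrite /Mc !multiplierE // => e.
  by apply/funext => h; apply: (scalerI (invr_neq0 c0)); exact: (congr1 (@^~ h) e).
pose a := invertible M /\
  inverse M = Mc (canonical_dual dot Psi) (canonical_dual dot Phi).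
pose d1 := invertible M /\ forall Phid, is_dual_frame dot Phi Phid ->
  inverse M = Mc (canonical_dual dot Psi) Phid.
pose d2 := invertible M /\ forall Psid, is_dual_frame dot Psi Psid ->
  inverse M = Mc Psid (canonical_dual dot Phi).
have ab : a -> equivalent_frames Phi Psi.
  by move=> [[_ _ bM]]; exact: multiplier_canonical_equivalent.
have bd1 : equivalent_frames Phi Psi -> d1.
  move=> [G iG PsiE]; split; first exact: multiplier_invertible iG PsiE.
  by move=> Phid; exact: inverse_multiplier_duall iG PsiE _.
have bd2 : equivalent_frames Phi Psi -> d2.
  move=> [G iG PsiE]; split; first exact: multiplier_invertible iG PsiE.
  by move=> Psid; exact: inverse_multiplier_dualr iG PsiE _.
have d1a : d1 -> a by move=> [iM Md]; split=> //; exact: Md.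
have d2a : d2 -> a by move=> [iM Md]; split=> //; exact: Md.
(* The cycle is (a), (b), (c1), (c2), (d1), (d2), (a); the arrows out of (c1), (c2) and (d1) go back
   through (a) and (b). *)
tfae.
- exact: ab.
(* Existence is (d1); a competitor has the same mixed operator with every dual of [Phi], so
   [mixed_dual_inj] identifies it. *)
- move=> /bd1[iM Md]; split=> //; split=> [//|X [dX MX]].
  have bX := dual_frame_bessel dX; have bC := dual_frame_bessel dPsi.
  apply: (mixed_dual_inj Hdot HPhi bC bX) => Phid dPhid.
  have bPhid := dual_frame_bessel dPhid.
  exact: McE (etrans (esym (Md _ dPhid)) (MX _ dPhid)).
- move=> [iM [[_ Md] _]].
  have [_ Md2] := bd2 (ab (d1a (conj iM Md))).
  split=> //; split=> [//|X [dX MX]].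
  have bX := dual_frame_bessel dX; have bC := dual_frame_bessel dPhi.
  apply: (mixed_dual_inj Hdot HPsi bC bX) => Psid dPsid.
  have bPsid := dual_frame_bessel dPsid.
  have e := McE _ _ _ _ bPsid bPsid bC bX (etrans (esym (Md2 _ dPsid)) (MX _ dPsid)).
  (* Here the competitor is the analysing sequence; taking adjoints moves it to the synthesis
     side. *)
  apply/funext => h; apply: (dot_inj (dot := dot)) => g.
  by rewrite !mixed_adjoint // e.
- by move=> [iM [[_ Md] _]]; exact: bd1 (ab (d2a (conj iM Md))).
- by move=> /d1a/ab/bd2.
- exact: d2a.
Qed.
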